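(* Consider the SBP-SAT semi-discretization described in the context for the homogeneous version of the parabolic PDE (i.e. $\mathcal F=0$, $\mathcal U_{\mathcal D}=0$, $\mathcal U_{\mathcal N}=0$), and let $\alpha_{\gamma\kappa}\ge 0$ be weights, one for each face $\gamma$ of each element $\kappa$, with $\sum_{\gamma\subset\Gamma_\kappa}\alpha_{\gamma\kappa}=1$ for every $\kappa$ and $\alpha_{\gamma\kappa}>0$ on all interior and Dirichlet faces. Assume that on every interior face $\gamma$, shared by elements $\kappa$ and $\nu$, the symmetric penalty matrices satisfy $$\Sigma^{(1)}_{\gamma\kappa}=\Sigma^{(1)}_{\gamma\nu}\equiv\Sigma^{(1)}_\gamma,\quad \Sigma^{(4)}_{\gamma\kappa}=\Sigma^{(4)}_{\gamma\nu}\equiv\Sigma^{(4)}_\gamma,\quad \Sigma^{(2)}_{\gamma\kappa}+\Sigma^{(2)}_{\gamma\nu}=-B_\gamma,\quad \Sigma^{(3)}_{\gamma\kappa}+\Sigma^{(3)}_{\gamma\nu}=B_\gamma,\quad \Sigma^{(3)}_{\gamma\kappa}-\Sigma^{(2)}_{\gamma\kappa}=B_\gamma .$$ Suppose that for every interior face $\gamma$ $$\Sigma^{(1)}_\gamma-\Sigma^{(2)}_{\gamma\kappa}C_{\gamma\kappa}\bigl(\alpha_{\gamma\kappa}\Lambda^*_\kappa\bigr)^{-1}C_{\gamma\kappa}^T\Sigma^{(2)}_{\gamma\kappa}-\Sigma^{(2)}_{\gamma\nu}C_{\gamma\nu}\bigl(\alpha_{\gamma\nu}\Lambda^*_\nu\bigr)^{-1}C_{\gamma\nu}^T\Sigma^{(2)}_{\gamma\nu}\succeq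 0\qquad\text{and}\qquad \Sigma^{(4)}_\gamma\succeq 0,$$ and for every Dirichlet face $\gamma$ (a face of element $\kappa$) $$\Sigma^{\mathcal D}_\gamma-B_\gamma C_{\gamma\kappa}\bigl(\alpha_{\gamma\kappa}\Lambda^*_\kappa\bigr)^{-1}C_{\gamma\kappa}^TB_\gamma\succeq 0 .$$ Here $A\succeq0$ means $A$ is positive semi-definite. Then every solution $w_h(t)$ of the homogeneous semi-discretization has non-increasing norm with respect to the $H$ matrix: $\sum_\kappa w_\kappa(t)^TH_\kappa w_\kappa(t)$ is a non-increasing function of $t$.
   Context: **Domain and PDE.** $\Omega\subset\mathbb R^2$ is a compact domain whose boundary is $\Gamma=\Gamma^{\mathcal D}\cup\Gamma^{\mathcal N}$ (disjoint, $\Gamma^{\mathcal D}\neq\emptyset$). $\Lambda=\begin{bmatrix}\lambda_{xx}&\lambda_{xy}\\ \lambda_{yx}&\lambda_{yy}\end{bmatrix}$ is a (possibly spatially varying) symmetric positive-definite tensor. The PDE is $\partial_t\mathcal U-\nabla\cdot(\Lambda\nabla\mathcal U)=\mathcal F$ with $\mathcal U=\mathcal U_{\mathcal D}$ on $\Gamma^{\mathcal D}$ and $\hat n\cdot(\Lambda\nabla\mathcal U)=\mathcal U_{\mathcal N}$ on $\Gamma^{\mathcal N}$. **Mesh.** $\Omega$ is partitioned into finitely many elements $\Omega_\kappa$ with piecewise smooth boundary $\Gamma_\kappa=\partial\Omega_\kappa$ consisting of finitely many faces. Each face $\gamma$ is either interior (shared by exactly two elements $\kappa,\nu$; the set of interior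 faces of $\kappa$ is $\Gamma^{\mathcal I}_\kappa$), or contained in $\Gamma^{\mathcal D}$ (Dirichlet face), or contained in $\Gamma^{\mathcal N}$ (Neumann face); $\Gamma_\kappa^{\mathcal D}=\Gamma_\kappa\cap\Gamma^{\mathcal D}$, $\Gamma_\kappa^{\mathcal N}=\Gamma_\kappa\cap\Gamma^{\mathcal N}$. **SBP operators of degree $p$.** Each element has $n_\kappa$ nodes, a diagonal matrix $H_\kappa$ with positive diagonal, and matrices $D_x,D_y\in\mathbb R^{n_\kappa\times n_\kappa}$ that differentiate exactly (in $x$, resp. $y$, at the nodes) the nodal values of every polynomial of total degree $\le p$. Moreover $H_\kappa D_x=S_x+\tfrac12E_x$ with $S_x^T=-S_x$, $E_x^T=E_x$, $p^TE_xq=\oint_{\partial\Omega_\kappa}\mathcal P\mathcal Q\,n_x\,d\Gamma$ for all polynomials $\mathcal P,\mathcal Q$ of total degree $\le r$ (with nodal vectors $p,q$), for some $r\ge p$, and $E_x=\sum_{\gamma\subset\Gamma_\kappa}R_{\gamma\kappa}^TN_{x,\gamma}B_\gamma R_{\gamma\kappa}$; analogously for $y$. Here each face $\gamma$ has $n_\gamma$ cubature nodes with positive weights (exact for degree $2r$), $B_\gamma$ is the diagonal matrix of the weights, $N_{x,\gamma},N_{y,\gamma}$ are the diagonal matrices of the components at the face nodes of the unit normal outward to $\kappa$, and $R_{\gamma\kappa}\in\mathbb R^{n_\gamma\times n_\kappa}$ maps the element nodal values of any polynomial of total degree $\le r$ exactly to its values at the nodes of $\gamma$. **Discrete operators.**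 $\Lambda_{xx},\Lambda_{xy},\Lambda_{yx},\Lambda_{yy}$ are the diagonal matrices of the entries of $\Lambda$ at the element nodes. On element $\kappa$: $D_\kappa=D_x(\Lambda_{xx}D_x+\Lambda_{xy}D_y)+D_y(\Lambda_{yx}D_x+\Lambda_{yy}D_y)$. On a face $\gamma$ of $\kappa$: $D_{\gamma\kappa}=N_{x,\gamma}R_{\gamma\kappa}(\Lambda_{xx}D_x+\Lambda_{xy}D_y)_\kappa+N_{y,\gamma}R_{\gamma\kappa}(\Lambda_{yx}D_x+\Lambda_{yy}D_y)_\kappa$ with the normal outward to $\kappa$; for the neighbour $\nu$ across $\gamma$, $D_{\gamma\nu}$ is the same expression with $\nu$'s operators and the opposite normal (outward to $\nu$). Further, $$C_{\gamma\kappa}=\begin{bmatrix}N_{x,\gamma}R_{\gamma\kappa}&N_{y,\gamma}R_{\gamma\kappa}\end{bmatrix},\quad C_{\gamma\nu}=-\begin{bmatrix}N_{x,\gamma}R_{\gamma\nu}&N_{y,\gamma}R_{\gamma\nu}\end{bmatrix},\quad \Lambda^*_\kappa=\begin{bmatrix}\Lambda_{xx}&\Lambda_{xy}\\ \Lambda_{yx}&\Lambda_{yy}\end{bmatrix}_\kappa^{-1}\begin{bmatrix}H_\kappa&0\\0&H_\kappa\end{bmatrix},$$ with $N_{x,\gamma},N_{y,\gamma}$ outward to $\kappa$, and $\Lambda^*_\nu$ defined likewise on $\nu$. **Semi-discretization.** $u_h$ is the concatenation of the vectors $u_\kappa\in\mathbb R^{n_\kappa}$. On each element, $\dfrac{du_\kappa}{dt}=D_\kappa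 u_\kappa+f_\kappa-H_\kappa^{-1}s^{\mathcal I}_\kappa-H_\kappa^{-1}s^{\mathcal B}_\kappa$, with $f_\kappa$ the nodal values of $\mathcal F$ and $$s^{\mathcal I}_\kappa(u_h)=\sum_{\gamma\subset\Gamma^{\mathcal I}_\kappa}\begin{bmatrix}R_{\gamma\kappa}^T&D_{\gamma\kappa}^T\end{bmatrix}\begin{bmatrix}\Sigma^{(1)}_{\gamma\kappa}&\Sigma^{(3)}_{\gamma\kappa}\\ \Sigma^{(2)}_{\gamma\kappa}&\Sigma^{(4)}_{\gamma\kappa}\end{bmatrix}\begin{bmatrix}R_{\gamma\kappa}u_\kappa-R_{\gamma\nu}u_\nu\\ D_{\gamma\kappa}u_\kappa+D_{\gamma\nu}u_\nu\end{bmatrix},$$ $$s^{\mathcal B}_\kappa=\sum_{\gamma\subset\Gamma^{\mathcal D}_\kappa}\begin{bmatrix}R_{\gamma\kappa}^T&D_{\gamma\kappa}^T\end{bmatrix}\begin{bmatrix}\Sigma^{\mathcal D}_\gamma\\-B_\gamma\end{bmatrix}(R_{\gamma\kappa}u_\kappa-u_{\gamma\mathcal D})+\sum_{\gamma\subset\Gamma^{\mathcal N}_\kappa}R_{\gamma\kappa}^TB_\gamma(D_{\gamma\kappa}u_\kappa-u_{\gamma\mathcal N}),$$ where $\nu$ is the element sharing $\gamma$ with $\kappa$, $u_{\gamma\mathcal D},u_{\gamma\mathcal N}$ are $\mathcal U_{\mathcal D},\mathcal U_{\mathcal N}$ at the nodes of $\gamma$ (zero in the homogeneous version, as is $f_\kappa$),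 and $\Sigma^{(i)}_{\gamma\kappa}$ ($i=1,\dots,4$), $\Sigma^{\mathcal D}_\gamma$ are symmetric $n_\gamma\times n_\gamma$ matrices. *)

(* Defs.v *)
From HB Require Import structures.
From mathcomp Require Import all_boot all_order all_algebra.
From mathcomp Require Import all_classical all_reals all_analysis.
(* The notations of mpoly clash with those of MathComp-Analysis. *)
From mathcomp Require mpoly.
Import (canonicals, coercions) mpoly.

Set Implicit Arguments.
Unset Strict Implicit.
Unset Printing Implicit Defensive.

Import Order.TTheory GRing.Theory Num.Theory.
Import numFieldNormedType.Exports.

Local Open Scope classical_set_scope.
Local Open Scope ring_scope.

Section Plane.
Variable R : realType.

Definition ix : 'I_2 := ord0.
Definition iy : 'I_2 := ord_max.
Definition xcoord (a : 'rV[R]_2) : R := a ord0 ix.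
Definition ycoord (a : 'rV[R]_2) : R := a ord0 iy.

(* The library norm on row vectors is the maximum norm. *)
Definition enorm (a : 'rV[R]_2) : R :=
  Num.sqrt (xcoord a ^+ 2 + ycoord a ^+ 2).

Definition poly2 : Type := mpoly.mpoly 2 R.
Definition peval (P : poly2) (a : 'rV[R]_2) : R :=
  mpoly.meval (fun i => a ord0 i) P.
(* msize is one more than the total degree, and is 0 for P = 0. *)
Definition deg_le (d : nat) (P : poly2) : Prop := (mpoly.msize P <= d.+1)%N.
Definition pdx (P : poly2) : poly2 := mpoly.mderiv ix P.
Definition pdy (P : poly2) : poly2 := mpoly.mderiv iy P.

Definition boundary (A : set 'rV[R]_2) : set 'rV[R]_2 :=
  closure A `\` interior A.

(* The closure of a nonempty connected open set, required to be compact. *)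
Definition compact_domain (A : set 'rV[R]_2) : Prop :=
  compact A /\
  exists U : set 'rV[R]_2, [/\ open U, connected U, U !=set0 & A = closure U].

(* Outward at a boundary point a of A: A lies locally on the side of -n. *)
Definition outward (A : set 'rV[R]_2) (a n : 'rV[R]_2) : Prop :=
  \forall e \near (0 : R)^'+, interior A (a - e *: n) /\ ~ A (a + e *: n).

(* A regular C^1 arc on [0,1] with velocity v, without self-intersection except
   that its two end points may coincide (a smooth closed curve). *)
Definition smooth_face (c v : R -> 'rV[R]_2) : Prop :=
  [/\ {within `[0, 1], continuous c},
      {within `[0, 1], continuous v},
      forall t : R, t \in `]0, 1[ -> is_derive t 1 c (v t),
      forall t : R, t \in `[0, 1] -> v t != 0
    & forall s t : R, 0 <= s -> s < t -> t <= 1 -> c s = c t ->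
        s = 0 /\ t = 1].

(* The two unit normals to a nonzero vector v. *)
Definition unit_normal (b : bool) (v : 'rV[R]_2) : 'rV[R]_2 :=
  (-1) ^+ b / enorm v *:
    \row_(i < 2) if i == ix then ycoord v else - xcoord v.

End Plane.

Arguments poly2 : clear implicits.

Inductive face_kind := Interior | Dirichlet | Neumann.

Section Mesh.
Variable R : realType.

Record mesh := Mesh {
  Omega : set 'rV[R]_2;
  GammaD : set 'rV[R]_2;
  GammaN : set 'rV[R]_2;
  Omega_domain : compact_domain Omega;
  Gamma_split : boundary Omega = GammaD `|` GammaN;
  Gamma_disj : GammaD `&` GammaN = set0;
  GammaD_nonempty : GammaD !=set0;

  elt : finType;
  face : finType;
  elem : elt -> set 'rV[R]_2;
  elem_nonempty : forall k, interior (elem k) !=set0;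
  elem_regular : forall k, elem k = closure (interior (elem k));
  elem_cover : \bigcup_(k in [set: elt]) elem k = Omega;
  elem_disj : forall k l, k != l ->
    interior (elem k) `&` interior (elem l) = set0;

  curve : face -> R -> 'rV[R]_2;
  velocity : face -> R -> 'rV[R]_2;
  face_smooth : forall g, smooth_face (curve g) (velocity g);
  face_disj : forall g h, g != h ->
    curve g @` `]0, 1[ `&` curve h @` `]0, 1[ = set0;

  faces : elt -> {set face};
  elem_boundary : forall k,
    boundary (elem k) = \bigcup_(g in [set g | g \in faces k])
                          (curve g @` `[0, 1]);

  kind : face -> face_kind;
  (* The containment in GammaD or GammaN is that of the arc without its end
     points: a Dirichlet face and a Neumann face may share an end point, which
     belongs to only one of the disjoint sets GammaD and GammaN. *)
  kindP : forall g,
    match kind g with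
    | Interior => #|[pred k | g \in faces k]| = 2%N
    | Dirichlet => #|[pred k | g \in faces k]| = 1%N /\
                   curve g @` `]0, 1[ `<=` GammaD
    | Neumann => #|[pred k | g \in faces k]| = 1%N /\
                 curve g @` `]0, 1[ `<=` GammaN
    end;

  (* orient k g selects which of the two unit normals along g is outward to
     the element k; orientP determines it when g is a face of k. *)
  orient : elt -> face -> bool;
  orientP : forall k g, g \in faces k -> forall t : R, t \in `]0, 1[ ->
    outward (elem k) (curve g t) (unit_normal (orient k g) (velocity g t))
}.

Variable M : mesh.

Definition normal (k : elt M) (g : face M) (t : R) : 'rV[R]_2 :=
  unit_normal (orient k g) (velocity g t).

Definition is_interior (g : face M) : bool :=
  if kind g is Interior then true else false.
Definition is_dirichlet (g : face M) : bool :=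
  if kind g is Dirichlet then true else false.
Definition is_neumann (g : face M) : bool :=
  if kind g is Neumann then true else false.

(* Arc-length integral of f over g; f is given along the parameter. *)
Definition face_integral (g : face M) (f : R -> R) : R :=
  \int[lebesgue_measure]_(t in `[0, 1]) (f t * enorm (velocity g t)).

Definition boundary_integral (k : elt M) (f : face M -> R -> R) : R :=
  \sum_(g in faces k) face_integral g (f g).

Definition spd2 (A : 'M[R]_2) : Prop :=
  A^T = A /\ forall v : 'cV[R]_2, v != 0 -> 0 < (v^T *m A *m v) 0 0.

(* Only applied to symmetric matrices. *)
Definition psd n (A : 'M[R]_n) : Prop :=
  forall v : 'cV[R]_n, 0 <= (v^T *m A *m v) 0 0.

End Mesh.

Section Operators.
Variables (R : realType) (M : mesh R).

Record sbp_operators (p : nat) := SbpOperators {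
  nn : elt M -> nat;
  node : forall k, 'I_(nn k) -> 'rV[R]_2;
  node_in : forall k i, elem k (@node k i);

  nf : face M -> nat;
  fpar : forall g, 'I_(nf g) -> R;
  fpar_in : forall g i, @fpar g i \in `[0, 1];

  Hw : forall k, 'rV[R]_(nn k);
  Hw_gt0 : forall k i, 0 < Hw k 0 i;
  Bw : forall g, 'rV[R]_(nf g);
  Bw_gt0 : forall g i, 0 < Bw g 0 i;

  Dx : forall k, 'M[R]_(nn k);
  Dy : forall k, 'M[R]_(nn k);
  Sx : forall k, 'M[R]_(nn k);
  Sy : forall k, 'M[R]_(nn k);
  Ex : forall k, 'M[R]_(nn k);
  Ey : forall k, 'M[R]_(nn k);
  (* Only meaningful for g \in faces k. *)
  Rop : forall (g : face M) (k : elt M), 'M[R]_(nf g, nn k);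

  nodal := fun k (P : poly2 R) => \col_i peval P (@node k i);
  fnodal := fun g (P : poly2 R) => \col_i peval P (curve g (@fpar g i));
  Nxw := fun k g => \row_i xcoord (normal k g (@fpar g i));
  Nyw := fun k g => \row_i ycoord (normal k g (@fpar g i));

  Dx_exact : forall k P, deg_le p P -> Dx k *m nodal k P = nodal k (pdx P);
  Dy_exact : forall k P, deg_le p P -> Dy k *m nodal k P = nodal k (pdy P);

  HDx : forall k, diag_mx (Hw k) *m Dx k = Sx k + 2^-1 *: Ex k;
  HDy : forall k, diag_mx (Hw k) *m Dy k = Sy k + 2^-1 *: Ey k;
  Sx_skew : forall k, (Sx k)^T = - Sx k;
  Sy_skew : forall k, (Sy k)^T = - Sy k;
  Ex_sym : forall k, (Ex k)^T = Ex k;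
  Ey_sym : forall k, (Ey k)^T = Ey k;

  rdeg : nat;
  rdeg_ge : (p <= rdeg)%N;
  Ex_exact : forall k P Q, deg_le rdeg P -> deg_le rdeg Q ->
    ((nodal k P)^T *m Ex k *m nodal k Q) 0 0 =
    boundary_integral k (fun g t => peval P (curve g t) * peval Q (curve g t)
                                    * xcoord (normal k g t));
  Ey_exact : forall k P Q, deg_le rdeg P -> deg_le rdeg Q ->
    ((nodal k P)^T *m Ey k *m nodal k Q) 0 0 =
    boundary_integral k (fun g t => peval P (curve g t) * peval Q (curve g t)
                                    * ycoord (normal k g t));
  Ex_faces : forall k, Ex k =
    \sum_(g in faces k)
      (Rop g k)^T *m diag_mx (Nxw k g) *m diag_mx (Bw g) *m Rop g k;
  Ey_faces : forall k, Ey k =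
    \sum_(g in faces k)
      (Rop g k)^T *m diag_mx (Nyw k g) *m diag_mx (Bw g) *m Rop g k;

  face_cubature : forall g P, deg_le (2 * rdeg) P ->
    \sum_i Bw g 0 i * peval P (curve g (@fpar g i)) =
    face_integral g (fun t => peval P (curve g t));
  Rop_exact : forall k g P, g \in faces k -> deg_le rdeg P ->
    Rop g k *m nodal k P = fnodal g P
}.

#[global] Arguments node {p} s {k} i : rename.
#[global] Arguments fpar {p} s {g} i : rename.

Variables (p : nat) (S : sbp_operators p) (Lam : 'rV[R]_2 -> 'M[R]_2).

Definition Hmx (k : elt M) : 'M[R]_(nn S k) := diag_mx (Hw S k).
Definition Bmx (g : face M) : 'M[R]_(nf S g) := diag_mx (Bw S g).
(* The normal is the one outward to the element k; the two elements sharing an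
   interior face thus get opposite normals. *)
Definition Nx (k : elt M) (g : face M) : 'M[R]_(nf S g) := diag_mx (Nxw S k g).
Definition Ny (k : elt M) (g : face M) : 'M[R]_(nf S g) := diag_mx (Nyw S k g).

Definition Lam_entry (a b : 'I_2) (k : elt M) : 'M[R]_(nn S k) :=
  diag_mx (\row_i Lam (node S i) a b).
Definition Lxx := Lam_entry ix ix.
Definition Lxy := Lam_entry ix iy.
Definition Lyx := Lam_entry iy ix.
Definition Lyy := Lam_entry iy iy.

Definition fluxx (k : elt M) : 'M[R]_(nn S k) :=
  Lxx k *m Dx S k + Lxy k *m Dy S k.
Definition fluxy (k : elt M) : 'M[R]_(nn S k) :=
  Lyx k *m Dx S k + Lyy k *m Dy S k.

Definition Dvol (k : elt M) : 'M[R]_(nn S k) :=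
  Dx S k *m fluxx k + Dy S k *m fluxy k.

Definition Dface (g : face M) (k : elt M) : 'M[R]_(nf S g, nn S k) :=
  Nx k g *m Rop S g k *m fluxx k + Ny k g *m Rop S g k *m fluxy k.

Definition Cown (g : face M) (k : elt M) : 'M[R]_(nf S g, nn S k + nn S k) :=
  row_mx (Nx k g *m Rop S g k) (Ny k g *m Rop S g k).

(* C for the neighbour l of k across g, with the normal outward to k. *)
Definition Cnbr (g : face M) (k l : elt M) :
    'M[R]_(nf S g, nn S l + nn S l) :=
  - row_mx (Nx k g *m Rop S g l) (Ny k g *m Rop S g l).

Definition LamStar (k : elt M) : 'M[R]_(nn S k + nn S k) :=
  invmx (block_mx (Lxx k) (Lxy k) (Lyx k) (Lyy k))
  *m block_mx (Hmx k) 0 0 (Hmx k).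

(* Entries indexed by (g, k) with g not a face of k, or not of the relevant
   kind, are never used. *)
Record sat_penalties := SatPenalties {
  Sig1 : forall (g : face M) (k : elt M), 'M[R]_(nf S g);
  Sig2 : forall (g : face M) (k : elt M), 'M[R]_(nf S g);
  Sig3 : forall (g : face M) (k : elt M), 'M[R]_(nf S g);
  Sig4 : forall (g : face M) (k : elt M), 'M[R]_(nf S g);
  SigD : forall g : face M, 'M[R]_(nf S g);
  Sig1_sym : forall g k, (Sig1 g k)^T = Sig1 g k;
  Sig2_sym : forall g k, (Sig2 g k)^T = Sig2 g k;
  Sig3_sym : forall g k, (Sig3 g k)^T = Sig3 g k;
  Sig4_sym : forall g k, (Sig4 g k)^T = Sig4 g k;
  SigD_sym : forall g, (SigD g)^T = SigD g
}.

Variable Sig : sat_penalties.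

(* The inner sum over l has exactly one term: the element sharing g with k. *)
Definition sat_interior (k : elt M) (u : forall l, 'cV[R]_(nn S l)) :
    'cV[R]_(nn S k) :=
  \sum_(g in faces k | is_interior g) \sum_(l | (l != k) && (g \in faces l))
    row_mx (Rop S g k)^T (Dface g k)^T
    *m block_mx (Sig1 Sig g k) (Sig3 Sig g k) (Sig2 Sig g k) (Sig4 Sig g k)
    *m col_mx (Rop S g k *m u k - Rop S g l *m u l)
              (Dface g k *m u k + Dface g l *m u l).

Definition face_values (f : 'rV[R]_2 -> R) (g : face M) : 'cV[R]_(nf S g) :=
  \col_i f (curve g (fpar S i)).

Definition sat_boundary (UD UN : 'rV[R]_2 -> R) (k : elt M)
    (u : forall l, 'cV[R]_(nn S l)) : 'cV[R]_(nn S k) :=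
  \sum_(g in faces k | is_dirichlet g)
    row_mx (Rop S g k)^T (Dface g k)^T
    *m col_mx (SigD Sig g) (- Bmx g)
    *m (Rop S g k *m u k - face_values UD g)
  + \sum_(g in faces k | is_neumann g)
    (Rop S g k)^T *m Bmx g *m (Dface g k *m u k - face_values UN g).

Definition semi_rhs (F UD UN : 'rV[R]_2 -> R) (k : elt M)
    (u : forall l, 'cV[R]_(nn S l)) : 'cV[R]_(nn S k) :=
  Dvol k *m u k + \col_i F (node S i)
  - invmx (Hmx k) *m sat_interior k u
  - invmx (Hmx k) *m sat_boundary UD UN k u.

(* Solutions on a time interval J of any form: continuous on J and satisfying
   the equations at its interior points. The data depend on time and space. *)
Definition semi_solution (F UD UN : R -> 'rV[R]_2 -> R) (J : interval R)
    (w : forall k, R -> 'cV[R]_(nn S k)) : Prop :=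
  forall k, {within [set` J], continuous (w k)} /\
    forall t : R, interior [set` J] t ->
      is_derive t 1 (w k) (semi_rhs (F t) (UD t) (UN t) k (fun l => w l t)).

Definition Hnorm2 (u : forall k, 'cV[R]_(nn S k)) : R :=
  \sum_k ((u k)^T *m Hmx k *m u k) 0 0.

End Operators.

(* Main.v *)
(* Energy method.  Write q for the nodal flux Lambda (grad_h w) on an element.
   Summation by parts turns w^T H D w into face terms minus q^T Lambda^* q, and
   this dissipation is distributed over the faces with the weights alpha.  After
   the penalty conditions have been used, the terms of an interior face, with
   d = R_k w_k - R_l w_l and the sum s of the two normal fluxes, are
     - d^T S1 d - s^T S4 s - 2 d^T S2_k C_k q_k + 2 d^T S2_l C_l q_l
     - alpha_k q_k^T Lambda^*_k q_k - alpha_l q_l^T Lambda^*_l q_l,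
   where C is taken with the outward normal of its element; Young's inequality
   2 z.q <= q^T A q + z^T A^-1 z with A = alpha Lambda^* reduces their sign to
   the assumed semi-definiteness.  Dirichlet faces are treated likewise. *)

Require Import Defs.
From HB Require Import structures.
From mathcomp Require Import all_boot all_order all_algebra.
From mathcomp Require Import all_classical all_reals all_analysis.
From mathcomp Require Import ring lra.

Set Implicit Arguments.
Unset Strict Implicit.
Unset Printing Implicit Defensive.

Import Order.TTheory GRing.Theory Num.Theory.
Import numFieldNormedType.Exports.

Local Open Scope classical_set_scope.
Local Open Scope ring_scope.

(** * Dot products, semi-definite forms and Young's inequality *)

Section DotProduct.
Variable R : realType.

Definition dot n (x y : 'cV[R]_n) : R := (x^T *m y) 0 0.

Lemma dotE n (x y : 'cV[R]_n) : dot x y = \sum_i x i 0 * y i 0.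
Proof. by rewrite /dot mxE; apply: eq_bigr => i _; rewrite mxE. Qed.

Lemma dotC n (x y : 'cV[R]_n) : dot x y = dot y x.
Proof. by rewrite !dotE; apply: eq_bigr => i _; rewrite mulrC. Qed.

Lemma dotDr n (x y z : 'cV[R]_n) : dot x (y + z) = dot x y + dot x z.
Proof. by rewrite /dot mulmxDr mxE. Qed.

Lemma dotNr n (x y : 'cV[R]_n) : dot x (- y) = - dot x y.
Proof. by rewrite /dot mulmxN mxE. Qed.

Lemma dotZr n a (x y : 'cV[R]_n) : dot x (a *: y) = a * dot x y.
Proof. by rewrite /dot -scalemxAr mxE. Qed.

Lemma dotDl n (x y z : 'cV[R]_n) : dot (y + z) x = dot y x + dot z x.
Proof. by rewrite !(dotC _ x) dotDr. Qed.

Lemma dotNl n (x y : 'cV[R]_n) : dot (- y) x = - dot y x.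
Proof. by rewrite !(dotC _ x) dotNr. Qed.

Definition dot_lin := (dotDl, dotDr, dotNl, dotNr).

Lemma dot_sumr n (I : finType) (P : pred I) (x : 'cV[R]_n) F :
  dot x (\sum_(i | P i) F i) = \sum_(i | P i) dot x (F i).
Proof. by rewrite /dot mulmx_sumr summxE. Qed.

Lemma dot_mulmx m n (A : 'M[R]_(m, n)) x y : dot x (A *m y) = dot (A^T *m x) y.
Proof. by rewrite /dot trmx_mul trmxK mulmxA. Qed.

Lemma dot_col_mx m n (a c : 'cV[R]_m) (b d : 'cV[R]_n) :
  dot (col_mx a b) (col_mx c d) = dot a c + dot b d.
Proof. by rewrite /dot tr_col_mx mul_row_col mxE. Qed.

Lemma psdE n (A : 'M[R]_n) : psd A <-> forall v, 0 <= dot v (A *m v).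
Proof. by split=> h v; have := h v; rewrite /dot mulmxA. Qed.

(** Expand the nonnegative form of [A] at [invmx A *m z - q]; by symmetry the two cross terms
    agree. *)
Lemma young_psd n (A : 'M[R]_n) (z q : 'cV[R]_n) :
  A^T = A -> A \in unitmx -> psd A ->
  2 * dot z q <= dot q (A *m q) + dot z (invmx A *m z).
Proof.
move=> At Au /psdE /(_ (invmx A *m z - q)).
rewrite mulmxBr (mulKVmx Au) !dot_lin (dot_mulmx A (invmx A *m z)) At
  (mulKVmx Au) !(dotC _ z).
by move=> h; rewrite -subr_ge0; apply: le_trans h _; lra.
Qed.

(** A nonzero row [v] in the left kernel of [A^T] gives [A *m v^T = 0], so the form would vanish at
    [v^T]. *)
Lemma posdef_unitmx n (A : 'M[R]_n) :
  (forall v, v != 0 -> 0 < dot v (A *m v)) -> A \in unitmx.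
Proof.
move=> pos; rewrite -unitmx_tr -row_free_unit -kermx_eq0.
apply/negPn/negP => /rowV0Pn[v /sub_kermxP vA v0].
have /pos : v^T != 0 by rewrite trmx_eq0.
suff -> : A *m v^T = 0 by rewrite /dot mulmx0 mxE ltxx.
by apply: trmx_inj; rewrite trmx_mul trmxK trmx0.
Qed.

End DotProduct.

(** * Tensors sampled at the nodes, and the matrix behind [LamStar] *)

Section NodalTensor.
Variables (R : realType) (n : nat).
Implicit Types T : 'I_n -> 'M[R]_2.

(** Up to a permutation of coordinates this is block diagonal with the 2 by 2 blocks [T i]. The
    block layout makes the matrix of Lambda in [LamStar] an instance by conversion. *)
Definition tensor_mx T : 'M[R]_(n + n) :=
  block_mx (diag_mx (\row_i T i ix ix)) (diag_mx (\row_i T i ix iy))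
           (diag_mx (\row_i T i iy ix)) (diag_mx (\row_i T i iy iy)).

Lemma diag_mx_mulE m (d : 'rV[R]_n) (A : 'M[R]_(n, m)) i j :
  (diag_mx d *m A) i j = d 0 i * A i j.
Proof. by rewrite mul_diag_mx mxE. Qed.

Lemma dot_tensor_mx T (v : 'cV[R]_(n + n)) :
  dot v (tensor_mx T *m v) =
  \sum_i (let c := \col_j (if j == ix then usubmx v i 0 else dsubmx v i 0) in
          (c^T *m T i *m c) 0 0).
Proof.
rewrite -{1 2}(vsubmxK v) mul_block_col dot_col_mx !dotE -big_split /=.
apply: eq_bigr => i _.
rewrite ![fun_of_matrix (_ + _) _ _]mxE !diag_mx_mulE !mxE.
rewrite !big_ord_recl big_ord0 !mxE !big_ord_recl !big_ord0 !mxE /=.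
have -> : lift ord0 ord0 = iy by apply: val_inj.
by rewrite -/ix; ring.
Qed.

(** The form decouples into one 2 by 2 form per node: a nonzero [v] has a nonzero pair of components
    at some node, and the other nodes contribute nonnegative terms. *)
Lemma tensor_mx_posdef T v : (forall i, spd2 (T i)) -> v != 0 ->
  0 < dot v (tensor_mx T *m v).
Proof.
move=> Tpos v0; rewrite dot_tensor_mx.
pose c i : 'cV[R]_2 :=
  \col_j (if j == ix then usubmx v i 0 else dsubmx v i 0).
have Tc i : c i != 0 -> 0 < ((c i)^T *m T i *m c i) 0 0 := (Tpos i).2 (c i).
have [i ci] : exists i, c i != 0.
  apply/existsP; apply: contraNT v0 => /existsPn c0.
  rewrite -(vsubmxK v) col_mx_eq0; apply/andP; split; apply/eqP/colP => i;
    have /negPn/eqP/colP ci := c0 i.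
  - by have := ci ix; rewrite !mxE.
  - by have := ci iy; rewrite !mxE.
rewrite (bigD1 i) //= ltr_wpDr ?Tc // sumr_ge0 // => j _.
rewrite -/(c j); have [->|/Tc/ltW//] := eqVneq (c j) 0.
by rewrite mulmx0 mxE.
Qed.

Lemma tensor_mx_sym T : (forall i, (T i)^T = T i) ->
  (tensor_mx T)^T = tensor_mx T.
Proof.
move=> Tsym; rewrite tr_block_mx !tr_diag_mx; congr block_mx;
  by congr diag_mx; apply/rowP => i; rewrite !mxE -[in LHS]Tsym mxE.
Qed.

Lemma tensor_mx_unit T : (forall i, spd2 (T i)) -> tensor_mx T \in unitmx.
Proof. by move=> Tpos; apply: posdef_unitmx => v; apply: tensor_mx_posdef. Qed.

Lemma tensor_mxM T (d : 'rV[R]_n) :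
  block_mx (diag_mx d) 0 0 (diag_mx d) *m tensor_mx T =
  tensor_mx (fun i => d 0 i *: T i).
Proof.
rewrite mulmx_block !mul0mx !addr0 !add0r !mulmx_diag.
by congr block_mx; congr diag_mx; apply/rowP => i; rewrite !mxE.
Qed.

(** All blocks are diagonal and both halves carry the same weights. This commutation is what makes
    the inverse tensor times the weights symmetric. *)
Lemma tensor_mxC T (d : 'rV[R]_n) :
  tensor_mx T *m block_mx (diag_mx d) 0 0 (diag_mx d) =
  block_mx (diag_mx d) 0 0 (diag_mx d) *m tensor_mx T.
Proof.
rewrite !mulmx_block !mul0mx !mulmx0 !addr0 !add0r.
by congr block_mx; apply: diag_mxC.
Qed.

Lemma spd2Z (a : R) (A : 'M[R]_2) : 0 < a -> spd2 A -> spd2 (a *: A).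
Proof.
move=> a0 [At Apos]; split=> [|v v0]; first by rewrite linearZ /= At.
by rewrite -scalemxAr -scalemxAl mxE mulr_gt0 // Apos.
Qed.

Lemma weight_unitmx (d : 'rV[R]_n) : (forall i, 0 < d 0 i) ->
  diag_mx d \in unitmx.
Proof.
move=> d0; rewrite unitmxE det_diag unitfE; apply/prodf_neq0 => i _.
by rewrite gt_eqF.
Qed.

Variables (T : 'I_n -> 'M[R]_2) (d : 'rV[R]_n).
Hypothesis T_spd : forall i, spd2 (T i).
Hypothesis d_gt0 : forall i, 0 < d 0 i.

Let D := block_mx (diag_mx d) 0 0 (diag_mx d).
Let A := invmx (tensor_mx T) *m D.

Lemma tensor_star_unit : A \in unitmx.
Proof.
rewrite unitmx_mul unitmx_inv tensor_mx_unit //=.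
by rewrite unitmxE det_ublock unitrM -unitmxE weight_unitmx.
Qed.

Lemma tensor_starE v : dot (tensor_mx T *m v) (A *m (tensor_mx T *m v)) =
  dot v (D *m (tensor_mx T *m v)).
Proof.
have Tt : (tensor_mx T)^T = tensor_mx T.
  by apply: tensor_mx_sym => i; have [] := T_spd i.
by rewrite [RHS]dot_mulmx -{1}Tt -dot_mulmx !mulmxA mulmxV ?tensor_mx_unit //
  mul1mx -dot_mulmx mulmxA.
Qed.

Lemma tensor_star_sym : A^T = A.
Proof.
have Tu := tensor_mx_unit T_spd.
rewrite trmx_mul trmx_inv tensor_mx_sym => [|i]; last by have [] := T_spd i.
have -> : D^T = D by rewrite tr_block_mx !trmx0 !tr_diag_mx.
apply: (can_inj (mulKmx Tu)); rewrite (mulKVmx Tu) mulmxA tensor_mxC -/D.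
by rewrite (mulmxK Tu).
Qed.

(** Substituting [q = tensor_mx T *m v] turns the form into that of the nodal tensor with blocks
    [d 0 i *: T i], which are again positive definite. *)
Lemma tensor_star_psd : psd A.
Proof.
have Tu := tensor_mx_unit T_spd.
apply/psdE => q; rewrite -[q](mulKVmx Tu) tensor_starE mulmxA tensor_mxM.
have [->|v0] := eqVneq (invmx (tensor_mx T) *m q) 0.
  by rewrite mulmx0 /dot mulmx0 mxE.
by apply/ltW/tensor_mx_posdef => // i; apply: spd2Z.
Qed.

End NodalTensor.

(** * Summation by parts and the energy balance on one element *)

Lemma sbp_by_parts (R : realType) n (h : 'rV[R]_n) (D S E : 'M[R]_n) :
  diag_mx h *m D = S + 2^-1 *: E -> S^T = - S -> E^T = E ->
  diag_mx h *m D = E - D^T *m diag_mx h.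
Proof.
move=> hD St Et.
(* Transposition flips the sign of [S] and keeps [E], so adding the transpose to [diag_mx h *m D]
   leaves [E]. *)
have -> : D^T *m diag_mx h = - S + 2^-1 *: E.
  by rewrite -(tr_diag_mx h) -trmx_mul hD linearD linearZ /= St Et.
rewrite hD opprD opprK addrCA -{2}[E]scale1r -scalerBl.
by congr (_ + _ *: _); lra.
Qed.

Section ElementEnergy.
Variables (R : realType) (M : mesh R) (p : nat) (S : sbp_operators M p).
Variable Lam : 'rV[R]_2 -> 'M[R]_2.
Hypothesis Lam_spd : forall x, Omega M x -> spd2 (Lam x).
Variable k : elt M.
Implicit Type u : 'cV[R]_(nn S k).

Definition flux u : 'cV[R]_(nn S k + nn S k) :=
  col_mx (fluxx S Lam k *m u) (fluxy S Lam k *m u).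

(** The discrete integral of grad u . Lambda grad u, expressed in the flux because the matrices C
    act on the flux. *)
Definition dissipation u : R := dot (flux u) (LamStar S Lam k *m flux u).

Let grad u := col_mx (Dx S k *m u) (Dy S k *m u).

Lemma node_spd (i : 'I_(nn S k)) : spd2 (Lam (node S i)).
Proof.
apply: Lam_spd; rewrite -elem_cover; exists k => //; exact: node_in.
Qed.

Lemma LamStar_unit : LamStar S Lam k \in unitmx.
Proof. exact: tensor_star_unit node_spd (@Hw_gt0 _ _ _ S k). Qed.

Lemma LamStar_sym : (LamStar S Lam k)^T = LamStar S Lam k.
Proof. exact: tensor_star_sym node_spd. Qed.

Lemma LamStar_psd : psd (LamStar S Lam k).
Proof. exact: tensor_star_psd node_spd (@Hw_gt0 _ _ _ S k). Qed.

Lemma flux_grad u :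
  flux u = tensor_mx (fun i : 'I_(nn S k) => Lam (node S i)) *m grad u.
Proof. by rewrite /tensor_mx mul_block_col !mulmxA -!mulmxDl. Qed.

Lemma dissipation_grad u :
  dissipation u = dot (Dx S k *m u) (Hmx S k *m (fluxx S Lam k *m u))
                + dot (Dy S k *m u) (Hmx S k *m (fluxy S Lam k *m u)).
Proof.
rewrite /dissipation flux_grad [LHS](tensor_starE _ node_spd) -flux_grad.
by rewrite mul_block_col !mul0mx addr0 add0r dot_col_mx.
Qed.

Lemma dissipation_ge0 u : 0 <= dissipation u.
Proof. exact: (psdE _).1 LamStar_psd _. Qed.

Lemma Dface_flux g u : Dface S Lam g k *m u = Cown S g k *m flux u.
Proof. by rewrite mul_row_col mulmxDl !mulmxA. Qed.

(** Young's inequality for [a *: LamStar S Lam k] at the vector [C^T *m (Z *m z)]. The last term is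
    the quadratic form subtracted in the penalty conditions, with [Z] equal to Sigma2 on interior
    faces and to B on Dirichlet faces. *)
Lemma dissipation_young (a : R) m (C : 'M[R]_(m, _)) (Z : 'M[R]_m)
    (z : 'cV[R]_m) u : Z^T = Z -> 0 < a ->
  2 * dot z (Z *m (C *m flux u)) <= a * dissipation u +
    dot z (Z *m C *m invmx (a *: LamStar S Lam k) *m C^T *m Z *m z).
Proof.
move=> Zt a0; have a_unit : a \is a GRing.unit by rewrite unitfE gt_eqF.
have := @young_psd _ _ (a *: LamStar S Lam k) (C^T *m (Z *m z)) (flux u).
rewrite linearZ /= LamStar_sym unitmxZ // LamStar_unit => /(_ erefl isT).
have apsd : psd (a *: LamStar S Lam k).
  apply/psdE => v; rewrite -scalemxAl dotZr mulr_ge0 ?(ltW a0) //.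
  exact: (psdE _).1 LamStar_psd _.
move=> /(_ apsd); rewrite -scalemxAl dotZr -/(dissipation u).
by rewrite !(dot_mulmx Z) !(dot_mulmx C) -!mulmxA
  !(dot_mulmx Z) !(dot_mulmx C) Zt.
Qed.

Lemma element_energy u :
  dot u (Hmx S k *m (Dvol S Lam k *m u)) =
  \sum_(g in faces k)
     dot (Rop S g k *m u) (Bmx S g *m (Dface S Lam g k *m u))
  - dissipation u.
Proof.
have bx := sbp_by_parts (HDx S k) (Sx_skew S k) (Ex_sym S k).
have by_ := sbp_by_parts (HDy S k) (Sy_skew S k) (Ey_sym S k).
rewrite dissipation_grad /Dvol mulmxDl mulmxDr !mulmxA /Hmx bx by_.
rewrite !(mulmxBl, =^~ mulmxA) !dot_lin !(dot_mulmx (_^T)) !trmxK.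
(* Boundary terms from [Ex] and [Ey] are separated from the volume terms, which form the
   dissipation. *)
rewrite -addrACA -opprD; congr (_ - _).
rewrite Ex_faces Ey_faces !mulmx_suml !dot_sumr -big_split /=.
apply: eq_bigr => g _.
rewrite -!mulmxA !(dot_mulmx (_^T)) !trmxK -dotDr; congr (dot _ _).
rewrite /Dface /Bmx /Nx /Ny mulmxDl mulmxDr !mulmxA.
(* The face decompositions have the normals before the weights, the goal the weights first; diagonal
   matrices commute. *)
by rewrite !(diag_mxC (Bw S g)).
Qed.

End ElementEnergy.

(** * Sign of the energy rate: face by face, then over the mesh *)

Section EnergyRate.
Variables (R : realType) (M : mesh R) (p : nat) (S : sbp_operators M p).
Variables (Lam : 'rV[R]_2 -> 'M[R]_2) (Sig : sat_penalties S).
Variable alpha : face M -> elt M -> R.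
Hypothesis Lam_spd : forall x, Omega M x -> spd2 (Lam x).

(* The sign is in fact +1, by the opposite orientations of the two normals; it
   is irrelevant here since Cnbr enters the hypotheses quadratically. *)
Lemma Cnbr_sign g (k l : elt M) : exists s : bool,
  Cnbr S g k l = (-1) ^+ s *: Cown S g l.
Proof.
(* The negation carries the minus sign in [Cnbr], the exclusive or the relative sign of the two
   normals. *)
exists (~~ (orient k g (+) orient l g)).
have normal_sign t :
    normal k g t = (-1) ^+ (orient k g (+) orient l g) *: normal l g t.
  rewrite /normal /unit_normal scalerA mulrA -signr_addb; congr (_ * _ *: _).
  by rewrite -addbA addbb addbF.
rewrite /Cnbr /Cown signrN scaleNr scale_row_mx; congr (- row_mx _ _);
  rewrite scalemxAl; congr (_ *m _); apply/matrixP => i j;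
  by rewrite /Nx /Ny !mxE /xcoord /ycoord normal_sign !mxE mulrnAr.
Qed.

Section Face.
Variables (u : forall l : elt M, 'cV[R]_(nn S l)) (g : face M).
Let a k := Rop S g k *m u k.
Let x k := Dface S Lam g k *m u k.
Let B := Bmx S g.

Definition interior_sat_work k l : R :=
  dot (a k) (Sig1 Sig g k *m (a k - a l) + Sig3 Sig g k *m (x k + x l)) +
  dot (x k) (Sig2 Sig g k *m (a k - a l) + Sig4 Sig g k *m (x k + x l)).

(** Boundary work from summation by parts, minus the share of the dissipation allotted to this
    face. *)
Definition face_work k : R :=
  dot (a k) (B *m x k) - alpha g k * dissipation Lam (u k).

Lemma interior_face_rate k l : 0 < alpha g k -> 0 < alpha g l ->
  [/\ Sig1 Sig g k = Sig1 Sig g l,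
      Sig4 Sig g k = Sig4 Sig g l,
      Sig2 Sig g k + Sig2 Sig g l = - Bmx S g,
      Sig3 Sig g k + Sig3 Sig g l = Bmx S g
    & Sig3 Sig g k - Sig2 Sig g k = Bmx S g] ->
  psd (Sig1 Sig g k
       - Sig2 Sig g k *m Cown S g k *m invmx (alpha g k *: LamStar S Lam k)
         *m (Cown S g k)^T *m Sig2 Sig g k
       - Sig2 Sig g l *m Cnbr S g k l *m invmx (alpha g l *: LamStar S Lam l)
         *m (Cnbr S g k l)^T *m Sig2 Sig g l) ->
  psd (Sig4 Sig g k) ->
  (face_work k - interior_sat_work k l) + (face_work l - interior_sat_work l k)
    <= 0.
Proof.
move=> ak al [S1 S4 S2 S3 S32] psd1 /psdE psd4.
have {psd1}/psdE psd1 : psd (Sig1 Sig g k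
       - Sig2 Sig g k *m Cown S g k *m invmx (alpha g k *: LamStar S Lam k)
         *m (Cown S g k)^T *m Sig2 Sig g k
       - Sig2 Sig g l *m Cown S g l *m invmx (alpha g l *: LamStar S Lam l)
         *m (Cown S g l)^T *m Sig2 Sig g l).
  (* The sign occurs twice in the product, hence squares to 1. *)
  move: psd1; have [s ->] := Cnbr_sign g k l.
  rewrite [(_ *: Cown S g l)^T]linearZ /= -?(scalemxAr, scalemxAl).
  rewrite scalerA -signr_addb addbb.
  by rewrite scale1r.
(* The cross terms are - 2 d^T S2_k x_k and + 2 d^T S2_l x_l, so Young is used at -d on [k] and at d
   on [l]. *)
have := dissipation_young Lam_spd (Cown S g k) (- (a k - a l)) (u k)
  (Sig2_sym Sig g k) ak.
have := dissipation_young Lam_spd (Cown S g l) (a k - a l) (u l)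
  (Sig2_sym Sig g l) al.
rewrite -!Dface_flux -/(x k) -/(x l) mulmxN.
have := psd1 (a k - a l); have := psd4 (x k + x l).
rewrite /face_work /interior_sat_work -S1 -S4.
set Qk := Sig2 Sig g k *m _ *m _ *m _ *m _.
set Ql := Sig2 Sig g l *m _ *m _ *m _ *m _.
set d := a k - a l.
have -> : a l - a k = - d by rewrite opprB.
have -> : a l = a k - d by rewrite /d opprB addrC subrK.
clearbody d; rewrite (addrC (x l)).
(* The remaining conditions express Sigma3 on both sides and Sigma2 on [l] through Sigma2 on [k] and
   B. All terms in [a k] except those in Sigma2 and Sigma1 of the jump then cancel, and the claim is
   linear in the dot products. *)
have S3k : Sig3 Sig g k = Sig2 Sig g k + B by rewrite /B -S32 addrC subrK.
have S3l : Sig3 Sig g l = - Sig2 Sig g k.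
  by apply: (addrI (Sig3 Sig g k)); rewrite S3 S3k addrAC subrr add0r.
have S2l : Sig2 Sig g l = - Sig2 Sig g k - B.
  by apply: (addrI (Sig2 Sig g k)); rewrite S2 addNKr.
rewrite S3k S3l S2l.
rewrite !(mulmxDr, mulmxDl, mulmxN, mulNmx) !dot_lin.
have sym (Z : 'M[R]_(nf S g)) y z : Z^T = Z -> dot y (Z *m z) = dot z (Z *m y).
  by move=> Zt; rewrite dot_mulmx Zt dotC.
have Bt : B^T = B by apply: tr_diag_mx.
have S2t := Sig2_sym Sig g k.
rewrite (sym _ (x k) d S2t) (sym _ (x l) d S2t) (sym _ (x l) d Bt).
rewrite !mulrDr.
lra.
Qed.

(** The adjoint penalty term with -B doubles the boundary work, giving 2 a^T B x, which Young's
    inequality with [Z] equal to B bounds. *)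
Lemma dirichlet_face_rate k : 0 < alpha g k ->
  psd (SigD Sig g
       - Bmx S g *m Cown S g k *m invmx (alpha g k *: LamStar S Lam k)
         *m (Cown S g k)^T *m Bmx S g) ->
  face_work k - dot (u k) (row_mx (Rop S g k)^T (Dface S Lam g k)^T
    *m col_mx (SigD Sig g) (- Bmx S g) *m a k) <= 0.
Proof.
move=> ak /psdE /(_ (a k)).
have Bt : B^T = B by apply: tr_diag_mx.
have := dissipation_young Lam_spd (Cown S g k) (a k) (u k) Bt ak.
rewrite -Dface_flux /face_work mul_row_col mulmxN -/B -/(x k).
rewrite !mulmxDl !mulNmx !dot_lin.
rewrite -!(mulmxA (_^T)) !(dot_mulmx (_^T)) !trmxK -/(a k) -/(x k).
rewrite (dot_mulmx B (x k)) Bt (dotC (B *m x k)).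
lra.
Qed.

End Face.

Lemma sat_interior_work k u :
  dot (u k) (sat_interior Lam Sig k u) =
  \sum_(g in faces k | is_interior g) \sum_(l | (l != k) && (g \in faces l))
    interior_sat_work u g k l.
Proof.
rewrite dot_sumr; apply: eq_bigr => g _.
rewrite dot_sumr; apply: eq_bigr => l _.
rewrite -mulmxA mul_block_col mul_row_col dotDr.
by rewrite !(dot_mulmx (_^T)) !trmxK.
Qed.

(** An interior face belongs to exactly two elements, so the sum has one term. This moves
    [face_work] inside the sum over neighbours. *)
Lemma neighbour_sum1 (g : face M) (k : elt M) (c : R) :
  is_interior g -> g \in faces k ->
  \sum_(l | (l != k) && (g \in faces l)) c = c.
Proof.
move=> gi gk; rewrite big_const -[RHS]addr0.
suff -> : #|[pred l | (l != k) && (g \in faces l)]| = 1%N by [].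
have := kindP g; move: gi; rewrite /is_interior; case: (kind g) => // _.
by rewrite (cardD1 k) inE gk => -[<-]; apply: eq_card => l; rewrite !inE.
Qed.

Hypothesis alpha_ge0 : forall k g, g \in faces k -> 0 <= alpha g k.
Hypothesis alpha_sum : forall k, \sum_(g in faces k) alpha g k = 1.
Hypothesis alpha_gt0 : forall k g, g \in faces k ->
  is_interior g || is_dirichlet g -> 0 < alpha g k.
Hypothesis dirichlet_psd : forall (g : face M) (k : elt M),
  is_dirichlet g -> g \in faces k ->
  psd (SigD Sig g
       - Bmx S g *m Cown S g k *m invmx (alpha g k *: LamStar S Lam k)
         *m (Cown S g k)^T *m Bmx S g).

(** Dirichlet and Neumann faces contribute nonpositive amounts and are dropped. Interior faces stay,
    since their sign is only known once both sides are combined. *)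
Lemma element_rate_le k (u : forall l : elt M, 'cV[R]_(nn S l)) :
  dot (u k) (Hmx S k *m semi_rhs Lam Sig (fun=> 0) (fun=> 0) (fun=> 0) k u) <=
  \sum_(g in faces k | is_interior g) \sum_(l | (l != k) && (g \in faces l))
    (face_work u g k - interior_sat_work u g k l).
Proof.
have Hu : Hmx S k \in unitmx by apply/weight_unitmx/Hw_gt0.
rewrite /semi_rhs (_ : (\col_i 0) = 0); last by apply/colP => i; rewrite !mxE.
rewrite addr0 !mulmxBr !(mulKVmx Hu) !dot_lin element_energy //.
(* As the weights sum to 1, the dissipation splits exactly over the faces. *)
have -> : \sum_(g in faces k) dot (Rop S g k *m u k)
      (Bmx S g *m (Dface S Lam g k *m u k)) - dissipation Lam (u k) =
    \sum_(g in faces k) face_work u g k.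
  by rewrite sumrB -mulr_suml alpha_sum mul1r.
have -> : \sum_(g in faces k | is_interior g)
      \sum_(l | (l != k) && (g \in faces l))
        (face_work u g k - interior_sat_work u g k l) =
    \sum_(g in faces k | is_interior g) face_work u g k
      - dot (u k) (sat_interior Lam Sig k u).
  rewrite sat_interior_work -sumrB; apply: eq_bigr => g /andP[gk gi].
  by rewrite sumrB neighbour_sum1.
rewrite (bigID (@is_interior _ M)) /=.
rewrite (bigID (@is_dirichlet _ M) (fun g => _ && ~~ _)) /=.
rewrite [X in _ + (X + _)](eq_bigl
  (fun g => (g \in faces k) && is_dirichlet g)); last first.
  by move=> g; rewrite /is_interior /is_dirichlet -andbA; case: (kind g).
rewrite [X in _ + (_ + X)](eq_bigl
  (fun g => (g \in faces k) && is_neumann g)); last first.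
  move=> g; rewrite /is_interior /is_dirichlet /is_neumann -andbA.
  by case: (kind g).
have face0 g : face_values S (fun=> 0) g = 0 by apply/colP => i; rewrite !mxE.
set dir := \sum_(g in faces k | is_dirichlet g) _.
set neu := \sum_(g in faces k | is_neumann g) _.
set satD := dot _ (\sum_(g in faces k | is_dirichlet g) _).
set satN := dot _ (\sum_(g in faces k | is_neumann g) _).
suff : dir + neu - (satD + satN) <= 0 by lra.
rewrite opprD addrACA /satD /satN !dot_sumr -!sumrB.
rewrite -[leRHS]addr0; apply: lerD; apply: sumr_le0 => g /andP[gk gt];
  rewrite face0 subr0.
  apply: dirichlet_face_rate; last exact: dirichlet_psd.
  by rewrite alpha_gt0 // gt orbT.
(* On a Neumann face the penalty cancels the boundary work, leaving minus a share of the
   dissipation. *)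
rewrite -!mulmxA dot_mulmx trmxK /face_work addrAC subrr add0r oppr_le0.
by rewrite mulr_ge0 ?alpha_ge0 ?dissipation_ge0.
Qed.

Hypothesis Sig_conditions : forall (g : face M) (k l : elt M),
  is_interior g -> g \in faces k -> g \in faces l -> k != l ->
  [/\ Sig1 Sig g k = Sig1 Sig g l,
      Sig4 Sig g k = Sig4 Sig g l,
      Sig2 Sig g k + Sig2 Sig g l = - Bmx S g,
      Sig3 Sig g k + Sig3 Sig g l = Bmx S g
    & Sig3 Sig g k - Sig2 Sig g k = Bmx S g].
Hypothesis interior_psd : forall (g : face M) (k l : elt M),
  is_interior g -> g \in faces k -> g \in faces l -> k != l ->
  psd (Sig1 Sig g k
       - Sig2 Sig g k *m Cown S g k *m invmx (alpha g k *: LamStar S Lam k)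
         *m (Cown S g k)^T *m Sig2 Sig g k
       - Sig2 Sig g l *m Cnbr S g k l *m invmx (alpha g l *: LamStar S Lam l)
         *m (Cnbr S g k l)^T *m Sig2 Sig g l)
  /\ psd (Sig4 Sig g k).

Lemma energy_rate_le0 (u : forall l : elt M, 'cV[R]_(nn S l)) :
  \sum_k dot (u k)
    (Hmx S k *m semi_rhs Lam Sig (fun=> 0) (fun=> 0) (fun=> 0) k u) <= 0.
Proof.
apply: le_trans (ler_sum _ (fun k _ => element_rate_le k u)) _.
rewrite (exchange_big_dep (@is_interior _ M)) /=; last by move=> k g _ /andP[].
apply: sumr_le0 => g gi.
under eq_bigl do rewrite gi andbT.
(* [X] runs over ordered pairs of elements sharing [g]. Adding a copy with the roles of [k] and [l]
   exchanged puts both sides of the face into each term, as [interior_face_rate] requires. *)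
set X := \sum_(k | _) _; suff : X + X <= 0 by lra.
rewrite {2}/X (exchange_big_dep (fun l => g \in faces l)) /=; last first.
  by move=> k l _ /andP[].
rewrite /X -big_split; apply: sumr_le0 => k gk /=.
under [X in _ + X]eq_bigl => l do
  rewrite gk andbT eq_sym andbC.
rewrite -big_split; apply: sumr_le0 => l /andP[lk gl] /=.
rewrite eq_sym in lk.
have [psd1 psd4] := interior_psd gi gk gl lk.
apply: interior_face_rate => //; try by apply: alpha_gt0; rewrite ?gi.
exact: Sig_conditions.
Qed.

End EnergyRate.

(** * Differentiating the norm in time *)

Lemma is_derive_coord (R : realFieldType) m n (f : R -> 'M[R]_(m, n)) (t : R)
    (df : 'M[R]_(m, n)) i j :
  is_derive t 1 f df -> is_derive t 1 (fun x => f x i j) (df i j).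
Proof.
move=> [fd fE]; split; first by move/derivable_mxP: fd; apply.
by rewrite -fE derive_mx // mxE.
Qed.

(** The equations hold only at interior points of [J]; this makes them available strictly between
    two times of [J], which may themselves be end points. *)
Lemma interior_itv_oo (R : realType) (J : interval R) (s t : R) :
  s \in J -> t \in J -> `]s, t[ `<=` interior [set` J].
Proof.
move=> sJ tJ; rewrite -open_subsetE; last exact: itv_open.
move=> x /=; rewrite in_itv /= => /andP[sx xt].
by apply: (interval_is_interval sJ tJ); rewrite (ltW sx) (ltW xt).
Qed.

Lemma is_derive_bigsum (R : numFieldType) (V W : normedModType R) (I : finType)
    (P : pred I) (h : I -> V -> W) (x v : V) (dh : I -> W) :
  (forall i, P i -> is_derive x v (h i) (dh i)) ->
  is_derive x v (\sum_(i | P i) h i) (\sum_(i | P i) dh i).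
Proof.
move=> hd; elim/big_rec2: _ => [|i y z Pi yz].
  exact: is_derive_cst.
by have := hd i Pi => ?; apply: is_deriveD.
Qed.

Section EnergyDerivative.
Variables (R : realType) (M : mesh R) (p : nat) (S : sbp_operators M p).
Variable w : forall k, R -> 'cV[R]_(nn S k).

(** Reduces the norm to scalar functions, whose derivatives and continuity are handled
    coordinatewise. *)
Lemma Hnorm2E t : Hnorm2 (fun k => w k t) =
  \sum_k \sum_i Hw S k 0 i * (w k t i 0 * w k t i 0).
Proof.
apply: eq_bigr => k _; rewrite -mulmxA -/(dot _ _) dotE.
by apply: eq_bigr => i _; rewrite diag_mx_mulE mulrCA.
Qed.

Lemma is_derive_Hnorm2 (t : R) (dw : forall k, 'cV[R]_(nn S k)) :
  (forall k, is_derive t 1 (w k) (dw k)) ->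
  is_derive t 1 (fun t => Hnorm2 (fun k => w k t))
    (2 * \sum_k dot (w k t) (Hmx S k *m dw k)).
Proof.
move=> wd; rewrite (_ : (fun _ => _) = \sum_k \sum_i
    (fun t => Hw S k 0 i * (w k t i 0 * w k t i 0))); last first.
  apply/funext => x; rewrite Hnorm2E fct_sumE; apply: eq_bigr => k _.
  by rewrite fct_sumE.
pose dE k i := Hw S k 0 i * (2 * (w k t i 0 * dw k i 0)).
have -> : 2 * (\sum_k dot (w k t) (Hmx S k *m dw k)) = \sum_k \sum_i dE k i.
  rewrite mulr_sumr; apply: eq_bigr => k _; rewrite dotE mulr_sumr.
  by apply: eq_bigr => i _; rewrite diag_mx_mulE /dE; ring.
apply: is_derive_bigsum => k _; apply: is_derive_bigsum => i _.
have wki := is_derive_coord i 0 (wd k).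
apply: is_derive_eq; rewrite /dE /GRing.scale /=; ring.
Qed.

Lemma continuous_Hnorm2 (A : set R) :
  (forall k, {within A, continuous (w k)}) ->
  {within A, continuous (fun t => Hnorm2 (fun k => w k t))}.
Proof.
move=> wc; under eq_fun do rewrite Hnorm2E.
move=> x; apply: (cvg_big add_continuous) => k _.
apply: (cvg_big add_continuous) => i _.
have wi : (w k t i 0 @[t --> nbhs (x : subspace A)]) --> w k x i 0.
  apply: (@continuous_comp (subspace A) _ _ (w k) (fun A => A i 0)).
    exact: wc.
  exact: coord_continuous.
by apply: cvgM; [exact: cvg_cst|exact: cvgM].
Qed.

End EnergyDerivative.

Theorem theorem2 (R : realType) (M : mesh R) (p : nat)
    (S : sbp_operators M p)
    (Lam : 'rV[R]_2 -> 'M[R]_2)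
    (Lam_spd : forall x, Omega M x -> spd2 (Lam x))
    (Sig : sat_penalties S)
    (alpha : face M -> elt M -> R)
    (alpha_ge0 : forall k g, g \in faces k -> 0 <= alpha g k)
    (alpha_sum : forall k, \sum_(g in faces k) alpha g k = 1)
    (alpha_gt0 : forall k g, g \in faces k ->
      is_interior g || is_dirichlet g -> 0 < alpha g k)
    (Sig_conditions : forall (g : face M) (k l : elt M),
      is_interior g -> g \in faces k -> g \in faces l -> k != l ->
      [/\ Sig1 Sig g k = Sig1 Sig g l,
          Sig4 Sig g k = Sig4 Sig g l,
          Sig2 Sig g k + Sig2 Sig g l = - Bmx S g,
          Sig3 Sig g k + Sig3 Sig g l = Bmx S g
        & Sig3 Sig g k - Sig2 Sig g k = Bmx S g])
    (interior_psd : forall (g : face M) (k l : elt M),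
      is_interior g -> g \in faces k -> g \in faces l -> k != l ->
      psd (Sig1 Sig g k
           - Sig2 Sig g k *m Cown S g k *m invmx (alpha g k *: LamStar S Lam k)
             *m (Cown S g k)^T *m Sig2 Sig g k
           - Sig2 Sig g l *m Cnbr S g k l *m invmx (alpha g l *: LamStar S Lam l)
             *m (Cnbr S g k l)^T *m Sig2 Sig g l)
      /\ psd (Sig4 Sig g k))
    (dirichlet_psd : forall (g : face M) (k : elt M),
      is_dirichlet g -> g \in faces k ->
      psd (SigD Sig g
           - Bmx S g *m Cown S g k *m invmx (alpha g k *: LamStar S Lam k)
             *m (Cown S g k)^T *m Bmx S g))
    (J : interval R)
    (w : forall k, R -> 'cV[R]_(nn S k))
    (w_solution : semi_solution Lam Sig (fun _ _ => 0) (fun _ _ => 0)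
                    (fun _ _ => 0) J w) :
  forall s t : R, s \in J -> t \in J -> s <= t ->
    Hnorm2 (fun k => w k t) <= Hnorm2 (fun k => w k s).
Proof.
move=> s t sJ tJ st.
have wd z : z \in `]s, t[ -> is_derive z 1 (fun x => Hnorm2 (fun k => w k x))
    (2 * \sum_k dot (w k z) (Hmx S k *m semi_rhs Lam Sig (fun=> 0) (fun=> 0)
      (fun=> 0) k (fun l => w l z))).
  move=> zst; apply: is_derive_Hnorm2 => k; apply: (w_solution k).2.
  exact: (interior_itv_oo sJ tJ).
have wc : {within `[s, t], continuous (fun x => Hnorm2 (fun k => w k x))}.
  apply: continuous_Hnorm2 => k; apply: continuous_subspaceW (w_solution k).1.
  by move=> z /=; rewrite in_itv /=; exact: interval_is_interval.
(* Continuity on the closed interval and a nonpositive derivative inside it suffice for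
   monotonicity, so nothing is asked of the derivative at [s] and [t]. *)
apply: (ler0_derive1_le_cc _ _ wc); rewrite ?in_itv /= ?lexx ?st // => z zst.
  by case: (wd z zst).
rewrite derive1E (@derive_val _ _ _ _ _ _ _ (wd z zst)) pmulr_rle0 //.
exact: (energy_rate_le0 Lam_spd alpha_ge0 alpha_sum).
Qed.
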